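(* Let $k\ge 3$, $2<p<n\le k$, and let $f\in P_k^n$ depend essentially on all of its $n$ variables. Then $f\in G_{p,k}^n$ if and only if there exist $n-p$ variables $y_{l_1},\ldots,y_{l_{n-p}}\in\{x_1,\ldots,x_n\}$ such that $f=h\oplus g$, where $h\in P_k^n$ satisfies $Ess(h)=\{y_{l_1},\ldots,y_{l_{n-p}}\}$ and $g\in G_{n,k}^n$. Moreover, when $f\in G_{p,k}^n$, such $h$ and $g$ can be chosen with $g_{i\leftarrow j}=0$ for all $1\le i,j\le n$ with $i\neq j$.
   Context: $K=\{0,1,\ldots,k-1\}$ is the ring of residues modulo $k$, $\oplus$ is addition modulo $k$ (applied pointwise to functions). $P_k^n$ is the set of all functions $K^n\to K$ in variables $x_1,\ldots,x_n$. A variable $x_i$ is essential in $g$ if changing only the $i$-th argument can change the value of $g$; $Ess(g)$ is the set of essential variables, $ess(g)=|Ess(g)|$. For $i\neq j$, $g_{i\leftarrow j}(a_1,\ldots,a_n)=g(a_1,\ldots,a_{i-1},a_j,a_{i+1},\ldots,a_n)$. $Min(g)$ is the set of all $g_{i\leftarrow j}$ with $i\neq j$ and $x_i,x_j\in Ess(g)$; $gap(g)=ess(g)-\max_{t\in Min(g)}ess(t)$. $G_{p,k}^m=\{f\in P_k^n: ess(f)=m,\ gap(f)=p\}$. *)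

(* Defs.v *)
From mathcomp Require Import all_boot all_order all_algebra.
Set Implicit Arguments.
Unset Strict Implicit.
Unset Printing Implicit Defensive.

(* The ring K of residues modulo k is 'Z_k, which is Z/kZ only when 1 < k.
   Both K^n and P_k^n are finite function types, so equality is extensional
   and the pointwise sum of functions is +%R on Pfun k n. *)
Notation Kn k n := {ffun 'I_n -> 'Z_k}.
Notation Pfun k n := {ffun Kn k n -> 'Z_k}.

Section EssentialVariables.
Variables (k n : nat).
Implicit Types (g : Pfun k n) (a : Kn k n) (i j : 'I_n).

Definition subst_at a i (v : 'Z_k) : Kn k n :=
  [ffun l => if l == i then v else a l].

Definition essential g i : bool :=
  [exists a : Kn k n, exists v : 'Z_k, g (subst_at a i v) != g a].

Definition Ess g : {set 'I_n} := [set i | essential g i].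

Definition ess g : nat := #|Ess g|.

(* g_{i <- j} *)
Definition minor g i j : Pfun k n := [ffun a => g (subst_at a i (a j))].

Definition Min g : {set Pfun k n} :=
  [set t | [exists i, exists j,
     [&& i != j, i \in Ess g, j \in Ess g & t == minor g i j]]].

(* A minor in Min g never has more essential variables than g, so the
   truncated subtraction is exact; when ess g < 2, Min g is empty and the
   maximum is 0 by convention. *)
Definition gap g : nat := ess g - \max_(t in Min g) ess t.

End EssentialVariables.

(* G_{p,k}^m inside P_k^n *)
Definition G (n p k m : nat) : {set Pfun k n} :=
  [set f | (ess f == m) && (gap f == p)].

(* Main.v *)
(** Write [m] for the largest number of essential variables of a minor of [f],
    so that [m = n - p].  Some minor [h = f_{r<-s}] with [ess h = m] does not
    depend on [x_s]: if the chosen one does, then identifying two of the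
    [p - 1 >= 2] variables other than [x_r] that are inessential in it gives one
    that does not.  For [x_t] inessential in [h] and distinct from [x_r] and
    [x_s], [h] is a minor of [f_{t<-u}]; by maximality of [m] no variable is
    lost between the two, which forces [f_{t<-u} = h].  These equalities imply
    [f_{i<-j} = h_{i<-j}] for all [i != j], so that all the minors of
    [g = f - h] vanish.  Conversely, the minors of a function [g] of gap [n] are
    constant, so that the minors of [h + g] depend on the same variables as
    those of [h]. *)
Require Import Defs.
From mathcomp Require Import all_boot all_order all_algebra.
From mathcomp Require Import zify.
Import GRing.Theory.
Set Implicit Arguments.
Unset Strict Implicit.
Unset Printing Implicit Defensive.
Local Open Scope ring_scope.

Lemma exists_notin (T : finType) (A : {set T}) :
  (#|A| < #|T|)%N -> exists x, x \notin A.
Proof.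
move=> ltA; have /card_gt0P[x] : (0 < #|~: A|)%N by have := cardsC A; lia.
by rewrite inE; exists x.
Qed.

Section EssentialVariables.
Variables (k n : nat).
Implicit Types (g h : Pfun k n) (a b : Kn k n) (i j l : 'I_n).

Lemma essentialP g i :
  reflect (exists a x, g (subst_at a i x) != g a) (i \in Ess g).
Proof.
rewrite inE; apply: (iffP existsP) => -[a].
  by case/existsP => x gx; exists a, x.
by case=> x gx; exists a; apply/existsP; exists x.
Qed.

Lemma inessential g i a x : i \notin Ess g -> g (subst_at a i x) = g a.
Proof.
move=> iN; apply/eqP; apply: contraNT iN => gx.
by apply/essentialP; exists a, x.
Qed.

Lemma eq_on_Ess g a b : {in Ess g, a =1 b} -> g a = g b.
Proof.
move=> eq_ab.
pose mix (s : seq 'I_n) : Kn k n := [ffun i => if i \in s then b i else a i].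
have mixE s : g (mix s) = g a.
  elim: s => [|i s IH]; first by congr (g _); apply/ffunP => l; rewrite ffunE.
  have [iE|iN] := boolP (i \in Ess g).
    rewrite -IH; congr (g _); apply/ffunP => l; rewrite !ffunE in_cons.
    by case: eqP => // ->; rewrite eq_ab ?if_same.
  rewrite -IH -(inessential (mix s) (b i) iN); congr (g _).
  by apply/ffunP => l; rewrite !ffunE in_cons; case: eqP => // ->.
rewrite -(mixE (enum 'I_n)); congr (g _).
by apply/ffunP => l; rewrite ffunE mem_enum.
Qed.

Lemma ess_le_arity g : (ess g <= n)%N.
Proof. by rewrite -[leqRHS]card_ord; exact: max_card. Qed.

Lemma exists_neq i : (1 < n)%N -> exists j, i != j.
Proof.
move=> n1; have [|j] := @exists_notin _ [set i].
  by rewrite cards1 card_ord.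
by rewrite in_set1 eq_sym; exists j.
Qed.

Lemma exists_inessential2 g i j :
  (ess g + 2 < n)%N -> exists l, [/\ l != i, l != j & l \notin Ess g].
Proof.
move=> lt_n; have [|l] := @exists_notin _ (i |: (j |: Ess g)).
  by rewrite !cardsU1 card_ord -/(ess g); lia.
by rewrite !in_setU1 !negb_or => /and3P[li lj lN]; exists l.
Qed.

Lemma Ess_setT g : (Ess g == [set: 'I_n]) = (ess g == n).
Proof. by rewrite eqEcard subsetT cardsT card_ord eqn_leq ess_le_arity. Qed.

Lemma ess0 : ess (0 : Pfun k n) = 0%N.
Proof.
by apply: eq_card0 => i; apply/negP => /essentialP[a [x]]; rewrite !ffunE eqxx.
Qed.

Lemma essDr g h : ess g = 0%N -> ess (h + g) = ess h.
Proof.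
move=> /cards0_eq g0; apply: eq_card => i; rewrite !inE.
apply: eq_existsb => a; apply: eq_existsb => x.
by rewrite !ffunE (@inessential g) ?g0 ?inE // (inj_eq (addIr _)).
Qed.

End EssentialVariables.

Section Minors.
Variables (k n : nat).
Implicit Types (f g h : Pfun k n) (a : Kn k n) (i j l r s t u v w : 'I_n).

Definition redirect i j l : 'I_n := if l == i then j else l.

Lemma minorE g i j a : minor g i j a = g [ffun l => a (redirect i j l)].
Proof.
rewrite ffunE; congr (g _); apply/ffunP => l.
by rewrite !ffunE /redirect; case: eqP.
Qed.

Lemma minorD f g i j : minor (f + g) i j = minor f i j + minor g i j.
Proof. by apply/ffunP => a; rewrite !ffunE. Qed.

Lemma minorB f g i j : minor (f - g) i j = minor f i j - minor g i j.
Proof. by apply/ffunP => a; rewrite !ffunE. Qed.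

Lemma minor_inessential g i j : i \notin Ess g -> minor g i j = g.
Proof. by move=> iN; apply/ffunP => a; rewrite ffunE inessential. Qed.

Lemma minorC g i j t u : t != i -> t != j -> u != i ->
  minor (minor g i j) t u = minor (minor g t u) i j.
Proof.
move=> ti tj ui; apply/ffunP => a; rewrite !minorE; congr (g _).
apply/ffunP => l; rewrite !ffunE /redirect; have [->|li] := eqVneq l i.
  by rewrite ![_ == t]eq_sym (negbTE ti) (negbTE tj) eqxx.
by case: (l == t); rewrite ?(negbTE li) ?(negbTE ui).
Qed.

Lemma minor_swap g i j : minor (minor g i j) j i = minor g j i.
Proof.
apply/ffunP => a; rewrite !minorE; congr (g _); apply/ffunP => l.
rewrite !ffunE /redirect.
by case: (eqVneq l i) => [->|//]; rewrite eqxx if_same.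
Qed.

Lemma minor_minor_inessential g t u v w :
    t != v -> t != w -> t \notin Ess (minor g v w) ->
  minor (minor g t u) v w = minor g v w.
Proof.
move=> tv tw tN; apply/ffunP => a.
rewrite -(inessential a (a (redirect v w u)) tN) !minorE; congr (g _).
apply/ffunP => l; rewrite !ffunE /redirect; have [->|lt] := eqVneq l t.
  by rewrite (negbTE tv) eqxx.
by case: (l == v); [rewrite eq_sym (negbTE tw) | rewrite (negbTE lt)].
Qed.

Lemma Ess_minor_sub g i j : Ess (minor g i j) \subset redirect i j @: Ess g.
Proof.
apply/subsetP => l; apply: contraLR => lN; apply/negP => /essentialP[a [x]].
rewrite !minorE => /eqP[]; apply: eq_on_Ess => e eE; rewrite !ffunE.
by case: eqP => // def_l; rewrite -def_l imset_f in lN.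
Qed.

Lemma ess_minor_le g i j : (ess (minor g i j) <= ess g)%N.
Proof.
exact: leq_trans (subset_leq_card (Ess_minor_sub g i j)) (leq_imset_card _ _).
Qed.

Lemma redirect_Ess_minor g i j l :
    (ess g <= ess (minor g i j))%N -> l \in Ess g ->
  redirect i j l \in Ess (minor g i j).
Proof.
move=> le_ess lE; suff /eqP -> : Ess (minor g i j) == redirect i j @: Ess g.
  exact: imset_f.
by rewrite eqEcard Ess_minor_sub (leq_trans (leq_imset_card _ _)).
Qed.

Lemma notin_Ess_minor_identified g i j : i != j -> i \notin Ess (minor g i j).
Proof.
move=> ij; apply/negP => /(subsetP (Ess_minor_sub g i j))/imsetP[l _].
by rewrite /redirect; case: eqVneq => [_|li] def_i;
  [rewrite def_i eqxx in ij | rewrite def_i eqxx in li].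
Qed.

Lemma notin_Ess_minor g i j l :
  l != j -> l \notin Ess g -> l \notin Ess (minor g i j).
Proof.
move=> lj; apply: contra => /(subsetP (Ess_minor_sub g i j))/imsetP[e eE].
by rewrite /redirect; case: eqP => _ def_l;
  [rewrite def_l eqxx in lj | rewrite def_l].
Qed.

Lemma eq_minor_of_ess_le f h t u v w :
    v \notin Ess h -> w \notin Ess h -> t \notin Ess h -> t != v -> t != w ->
    minor f v w = h -> (ess (minor f t u) <= ess h)%N ->
  minor f t u = h.
Proof.
move=> vN wN tN tv tw def_h le_ess.
have minor_h : minor (minor f t u) v w = h.
  by rewrite minor_minor_inessential ?def_h.
have vM : v \notin Ess (minor f t u).
  apply: contra wN => vM; have := @redirect_Ess_minor (minor f t u) v w v.
  by rewrite minor_h /redirect eqxx => ->.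
by rewrite -(minor_inessential w vM).
Qed.

Lemma eq_of_minor_inessential g h i j :
  i \notin Ess g -> i \notin Ess h -> minor g j i = minor h j i -> g = h.
Proof.
move=> iNg iNh gh.
rewrite -(minor_inessential j iNg) -(minor_inessential j iNh).
by rewrite -minor_swap gh minor_swap.
Qed.

End Minors.

Section LargestMinor.
Variables (k n : nat).
Implicit Types (f g h : Pfun k n) (i j r s : 'I_n).

Definition max_minor_ess g : nat :=
  \max_(ij : 'I_n * 'I_n | ij.1 != ij.2) ess (minor g ij.1 ij.2).

Lemma ess_minor_le_max g i j :
  i != j -> (ess (minor g i j) <= max_minor_ess g)%N.
Proof.
exact: (@leq_bigmax_cond _ _ (fun ij => ess (minor g ij.1 ij.2)) (i, j)).
Qed.

Lemma max_minor_ess_le g : (max_minor_ess g <= ess g)%N.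
Proof. by apply/bigmax_leqP => ij _; exact: ess_minor_le. Qed.

Lemma exists_max_minor g : (1 < n)%N ->
  exists i j, i != j /\ ess (minor g i j) = max_minor_ess g.
Proof.
move=> n1; pose offdiag := [pred ij : 'I_n * 'I_n | ij.1 != ij.2].
have [|[i j] ij max_ij] :=
    @eq_bigmax_cond _ offdiag (fun ij => ess (minor g ij.1 ij.2)).
  by apply/card_gt0P; exists (Ordinal (ltnW n1), Ordinal n1).
by exists i, j.
Qed.

Lemma max_minor_ess_inessential h :
  (1 < n)%N -> (ess h < n)%N -> max_minor_ess h = ess h.
Proof.
move=> n1 h_n; apply/eqP; rewrite eqn_leq max_minor_ess_le /=.
have [|i iN] := @exists_notin _ (Ess h); first by rewrite card_ord.
have [j ij] := exists_neq i n1.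
by have := ess_minor_le_max h ij; rewrite minor_inessential.
Qed.

Lemma bigmax_MinE g :
  Ess g = [set: 'I_n] -> \max_(t in Min g) ess t = max_minor_ess g.
Proof.
move=> gT; apply/eqP; rewrite eqn_leq; apply/andP; split; apply/bigmax_leqP.
  move=> t; rewrite inE => /existsP[i /existsP[j /and4P[ij _ _ /eqP ->]]].
  exact: ess_minor_le_max.
move=> [i j] /= ij; apply: (bigmax_sup (minor g i j)) => //.
rewrite inE; apply/existsP; exists i; apply/existsP; exists j.
by rewrite ij gT !in_setT eqxx.
Qed.

Lemma mem_G_full g p : (p <= n)%N ->
  (g \in G n p k n) = (Ess g == [set: 'I_n]) && (max_minor_ess g == n - p)%N.
Proof.
move=> pn; rewrite inE Ess_setT; apply: andb_id2l => /eqP gn.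
have /eqP gT : Ess g == [set: 'I_n] by rewrite Ess_setT gn.
rewrite /gap bigmax_MinE // gn.
by have := max_minor_ess_le g; rewrite gn; lia.
Qed.

Lemma max_minor_essDr h g :
  g \in G n n k n -> max_minor_ess (h + g) = max_minor_ess h.
Proof.
rewrite mem_G_full // subnn => /andP[_ /eqP g0].
apply: eq_bigr => -[i j] /= ij; rewrite minorD essDr //.
by apply/eqP; rewrite -leqn0 -g0 ess_minor_le_max.
Qed.

Lemma minors0_mem_G g :
    (1 < n)%N -> g != 0 -> (forall i j, i != j -> minor g i j = 0) ->
  g \in G n n k n.
Proof.
move=> n1 gN0 gm; rewrite mem_G_full // subnn; apply/andP; split; last first.
  by rewrite -leqn0; apply/bigmax_leqP => -[i j] ij; rewrite gm // ess0.
have [a ga] : exists a, g a != 0.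
  apply/existsP; apply: contraNT gN0; rewrite negb_exists => /forallP g0.
  by apply/eqP/ffunP => a; rewrite ffunE; apply/eqP; rewrite -[_ == _]negbK g0.
rewrite -subTset; apply/subsetP => i _.
have [j ij] := exists_neq i n1; apply/essentialP; exists a, (a j).
by have /ffunP/(_ a) := gm i j ij; rewrite !ffunE eq_sym => ->.
Qed.

Lemma exists_max_minor_inessential f :
    (max_minor_ess f + 2 < n)%N ->
  exists r s, [/\ r != s, s \notin Ess (minor f r s)
                & ess (minor f r s) = max_minor_ess f].
Proof.
move=> lt_n; have [|r [s [rs ess_h]]] := exists_max_minor f; first by lia.
have rN : r \notin Ess (minor f r s) by exact: notin_Ess_minor_identified.
have [sE|sN] := boolP (s \in Ess (minor f r s)); last by exists r, s.
rewrite -ess_h in lt_n.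
have [u [ur _ uN]] := exists_inessential2 r r lt_n.
have [t [tr tu tN]] := exists_inessential2 r u lt_n.
have ts : t != s by apply: contraNneq tN => ->.
have minor_h : minor (minor f t u) r s = minor f r s.
  exact: minor_minor_inessential.
have ess_tu : ess (minor f t u) = max_minor_ess f.
  apply/eqP; rewrite eqn_leq ess_minor_le_max //=.
  by rewrite -ess_h -minor_h ess_minor_le.
exists t, u; split=> //; apply: contra uN => uM.
have := @redirect_Ess_minor _ _ (minor f t u) r s u.
by rewrite /redirect (negbTE ur) minor_h ess_tu ess_h => ->.
Qed.

End LargestMinor.

Section MaximalMinor.
Variables (k n : nat) (f : Pfun k n) (r s : 'I_n).
Implicit Types (d e t u v w : 'I_n).
Let h := minor f r s.
Hypothesis rs : r != s.
Hypothesis sN : s \notin Ess h.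
Hypothesis ess_h : ess h = max_minor_ess f.
Hypothesis lt_n : (ess h + 2 < n)%N.

Lemma minor_inessential_maximal t u :
  t \notin Ess h -> t != u -> minor f t u = h.
Proof.
have rN : r \notin Ess h by exact: notin_Ess_minor_identified.
have le_h i j : i != j -> (ess (minor f i j) <= ess h)%N.
  by rewrite ess_h; exact: ess_minor_le_max.
have outside v w : v \notin Ess h -> v != r -> v != s -> v != w ->
    minor f v w = h.
  by move=> vN vr vs vw; apply: (eq_minor_of_ess_le rN sN) => //; exact: le_h.
move=> tN tu; have [v [vr vs vN]] := exists_inessential2 r s lt_n.
have [t_r|tr] := eqVneq t r.
  apply: (eq_minor_of_ess_le vN sN tN); rewrite ?le_h ?outside // t_r //.
  by rewrite eq_sym.
have [t_s|ts] := eqVneq t s; last exact: outside.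
by apply: (eq_minor_of_ess_le vN rN tN); rewrite ?le_h ?outside // t_s eq_sym.
Qed.

Lemma minor_minor_maximal d e : d != e -> minor f d e = minor h d e.
Proof.
move=> de; set M := minor f d e; set N := minor h d e.
have [t [td te tN]] := exists_inessential2 d e lt_n.
have minor_M u : u != d -> t != u -> minor M t u = N.
  by move=> ud tu; rewrite /M minorC // minor_inessential_maximal.
have [tM|tM] := boolP (t \in Ess M); last first.
  by rewrite -(minor_inessential e tM) minor_M // eq_sym.
have [|c [cd ce cM]] := @exists_inessential2 _ _ M d e.
  by apply: leq_ltn_trans lt_n; rewrite leq_add2r ess_h ess_minor_le_max.
have tc : t != c by apply: contraNneq cM => <-.
have cN : c \notin Ess N.
  by rewrite -(minor_M e _ te) 1?eq_sym // notin_Ess_minor.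
apply: (eq_of_minor_inessential (j := t) cM cN).
by rewrite minor_M // minor_inessential // notin_Ess_minor.
Qed.

End MaximalMinor.

Lemma exists_minors0_decomposition (k n : nat) (f : Pfun k n) :
    (max_minor_ess f + 2 < n)%N -> (max_minor_ess f < ess f)%N ->
  exists h g, [/\ f = h + g, ess h = max_minor_ess f, g \in G n n k n
    & forall i j, i != j -> minor g i j = 0].
Proof.
move=> lt_n gap_gt0.
have [r [s [rs sN ess_h]]] := exists_max_minor_inessential lt_n.
set h := minor f r s in ess_h; rewrite -ess_h in lt_n; exists h, (f - h).
have g0 i j : i != j -> minor (f - h) i j = 0.
  by move=> ij; rewrite minorB (minor_minor_maximal rs sN ess_h lt_n ij) subrr.
split=> //; first by rewrite addrC subrK.
apply: minors0_mem_G => //; first by lia.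
by rewrite subr_eq0; apply: contraTneq gap_gt0 => def_f;
  rewrite [in ess f]def_f ess_h ltnn.
Qed.

Theorem theorem3p9 (k n p : nat) (f : Pfun k n)
    (hk : (3 <= k)%N) (hp : (2 < p)%N) (hpn : (p < n)%N) (hnk : (n <= k)%N)
    (hf : Ess f = [set: 'I_n]) :
  (f \in G n p k n <->
     exists Y : {set 'I_n}, #|Y| = (n - p)%N /\
       exists h g : Pfun k n,
         f = h + g /\ Ess h = Y /\ g \in G n n k n)
  /\
  (f \in G n p k n ->
     exists Y : {set 'I_n}, #|Y| = (n - p)%N /\
       exists h g : Pfun k n,
         f = h + g /\ Ess h = Y /\ g \in G n n k n /\
         forall i j : 'I_n, i != j -> minor g i j = 0).
Proof.
have ess_f : ess f = n by apply/eqP; rewrite -Ess_setT hf.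
have memG : (f \in G n p k n) = (max_minor_ess f == n - p)%N.
  by rewrite mem_G_full ?hf ?eqxx // ltnW.
have decompose : f \in G n p k n ->
     exists Y : {set 'I_n}, #|Y| = (n - p)%N /\
       exists h g : Pfun k n,
         f = h + g /\ Ess h = Y /\ g \in G n n k n /\
         forall i j : 'I_n, i != j -> minor g i j = 0.
  rewrite memG => /eqP max_f.
  have [||h [g [fE ess_h gG g0]]] := @exists_minors0_decomposition _ _ f;
    [lia | lia |].
  by exists (Ess h); split; [rewrite -max_f | exists h, g].
split=> //; split=> [/decompose[Y [cardY [h [g [fE [hY [gG _]]]]]]]|].
  by exists Y; split=> //; exists h, g.
case=> Y [cardY [h [g [fE [hY gG]]]]].
have ess_h : ess h = (n - p)%N by rewrite /ess hY.
by rewrite memG fE max_minor_essDr // max_minor_ess_inessential ?ess_h //; lia.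
Qed.
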